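(* Let $n\ge 2$ and let $\mathcal{P}$ be a finite cyclically ordered subset of $S^1$. The injective homomorphism $\mu:\mathcal{RT}_n(\mathcal{P})\to\mathcal{DR}_n(\mathcal{P}_{n-1})$ determined by $$\mu\left(\frac{yx}{zx}\right)=E(x_1,\dots,x_{n-1}\,|\,y_1,z_1)$$ is Poisson with respect to the swapping brackets (of $\mathcal{Q}_n(\mathcal{P})$ and of $\mathcal{Q}_n(\mathcal{P}_{n-1})$), i.e. $\mu(\{f,g\})=\{\mu(f),\mu(g)\}$ for all $f,g\in\mathcal{RT}_n(\mathcal{P})$.
   Context: **Swapping algebra.** Let $\mathcal{P}\subset S^1$, $\mathbb{K}$ a field of characteristic zero. An ordered pair $(x,y)$ of points of $\mathcal{P}$ is written $xy$. $\mathcal{Z}(\mathcal{P})=\mathbb{K}[\{xy\}_{x,y\in\mathcal{P}}]/(\{xx\}_{x\in\mathcal{P}})$. For $r,x,s,y\in\mathcal{P}$ choose $o\in S^1$ different from them and a homeomorphism $\sigma:S^1\setminus o\to\mathbb{R}$ compatible with the anticlockwise orientation; with $\operatorname{sgn}(a)\in\{-1,0,1\}$ the sign of $a$, the linking number is $$\mathcal{J}(rx,sy)=\tfrac12\operatorname{sgn}(\sigma(r)-\sigma(x))\operatorname{sgn}(\sigma(r)-\sigma(y))\operatorname{sgn}(\sigma(y)-\sigma(x))-\tfrac12\operatorname{sgn}(\sigma(r)-\sigma(x))\operatorname{sgn}(\sigma(r)-\sigma(s))\operatorname{sgn}(\sigma(s)-\sigma(x)).$$ The swapping bracket on $\mathcal{Z}(\mathcal{P})$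 is $\{rx,sy\}=\mathcal{J}(rx,sy)\cdot ry\cdot sx$ on generators, extended by Leibniz's rule. Write $\Delta((x_1,\dots,x_d),(y_1,\dots,y_d))=\det(x_iy_j)_{i,j=1}^d$. $R_n(\mathcal{P})$ is the (Poisson) ideal generated by all $\Delta((x_1,\dots,x_{n+1}),(y_1,\dots,y_{n+1}))$; $\mathcal{Z}_n(\mathcal{P})=\mathcal{Z}(\mathcal{P})/R_n(\mathcal{P})$ is an integral domain with field of fractions $\mathcal{Q}_n(\mathcal{P})$, to which the bracket extends. **Determinant ratio.** For distinct $x_1,\dots,x_{n-1},y$ and any $t$ in the point set, $E(x_1,\dots,x_{n-1}|t,y)=\dfrac{\Delta((x_1,\dots,x_{n-1},t),(v_1,\dots,v_n))}{\Delta((x_1,\dots,x_{n-1},y),(v_1,\dots,v_n))}$ for any distinct $v_1,\dots,v_n$ in the point set (the value in the field of fractions does not depend on the $v_i$). **The map $\mu$.** For $\mathcal{P}=\{s\prec w\prec\cdots\prec t\prec s\}$ in anticlockwise order, let $\mathcal{P}_{n-1}=\{s_{n-1}\prec\cdots\prec s_1\prec w_{n-1}\prec\cdots\prec w_1\prec\cdots\prec t_{n-1}\prec\cdots\prec t_1\prec s_{n-1}\}\subset S^1$: each $r\in\mathcal{P}$ is replaced by $n-1$ nearby anticlockwise ordered points $r_{n-1},\dots,r_1$. $\mathcal{RT}_n(\mathcal{P})$ is the sub-fraction ring (subfield generated over $\mathbb{K}$) of $\mathcal{Q}_n(\mathcal{P})$ generated by all elements $\frac{yx}{zx}$ with $x,y,z\in\mathcal{P}$,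 $z\ne x$. $\mathcal{DR}_n(\mathcal{P}_{n-1})$ is the sub-fraction ring of $\mathcal{Q}_n(\mathcal{P}_{n-1})$ generated by all elements $E(x_1,\dots,x_{n-1}|y_1,z_1)$ with $x,y,z\in\mathcal{P}$, $z\neq x$. $\mu$ is the $\mathbb{K}$-algebra homomorphism extending the given formula on generators (it is well-defined and injective). *)

(* Defs.v *)
From HB Require Import structures.
From mathcomp Require Import all_boot all_order all_algebra.
From mathcomp Require Import boolp reals mpoly ring.

Set Implicit Arguments.
Unset Strict Implicit.
Unset Printing Implicit Defensive.

Import Order.TTheory GRing.Theory Num.Theory.
Local Open Scope ring_scope.
Local Open Scope quotient_scope.

Section Circle.
Variable R : realType.

Definition S1 := {p : R * R | p.1 ^+ 2 + p.2 ^+ 2 == 1}.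

(* Stereographic projection from o. If p is at anticlockwise angle
   a in ]0, 2 pi[ from o, its value is - sin a / (1 - cos a) = - cot (a / 2),
   which increases from -oo to +oo; so stereo o is a homeomorphism from
   S1 minus o to R compatible with the anticlockwise orientation. *)
Definition stereo (o p : S1) : R :=
  - ((val o).1 * (val p).2 - (val o).2 * (val p).1)
  / (1 - ((val o).1 * (val p).1 + (val o).2 * (val p).2)).

(* The points of s are distinct and are met in this order when travelling
   once anticlockwise around the circle. *)
Definition anticlockwise (s : seq S1) :=
  exists2 o : S1, o \notin s & sorted <%R (map (stereo o) s).

Definition ratpt (k : nat) : R * R :=
  ((1 - k%:R ^+ 2) / (1 + k%:R ^+ 2), (2 * k%:R) / (1 + k%:R ^+ 2)).

Fact ratpt_den (k : nat) : 1 + k%:R ^+ 2 != 0 :> R.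
Proof. by rewrite gt_eqF // ltr_pwDl // sqr_ge0. Qed.

Fact ratptP (k : nat) : (ratpt k).1 ^+ 2 + (ratpt k).2 ^+ 2 == 1.
Proof. by apply/eqP; rewrite /=; field; apply: ratpt_den. Qed.

Fact ratpt_inj : injective ratpt.
Proof.
move=> j k [] e1 e2; apply/eqP; rewrite -(eqr_nat R).
have tE (i : nat) : i%:R = (ratpt i).2 / (1 + (ratpt i).1) :> R.
  rewrite /=; field; rewrite ratpt_den /=.
  by rewrite [X in X != 0](_ : _ = 2%:R) ?pnatr_eq0 //; ring.
by rewrite (tE j) (tE k) /ratpt /= e1 e2.
Qed.

Fact off_point_exists (s : seq S1) : exists o : S1, o \notin s.
Proof.
pose f k : S1 := exist _ (ratpt k) (ratptP k).
have finj : injective f by move=> j k [] e1 e2; apply: ratpt_inj; congr pair.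
have [/allP sub|/allPn[o _ ho]] :=
  boolP (all (mem s) [seq f k | k <- iota 0 (size s).+1]); last by exists o.
have: (size [seq f k | k <- iota 0 (size s).+1] <= size s)%N.
  by apply: uniq_leq_size; rewrite ?map_inj_uniq ?iota_uniq.
by rewrite size_map size_iota ltnn.
Qed.

Definition off_point (s : seq S1) : S1 := xchoose (off_point_exists s).

(* The value does not depend on the choice of the removed point. *)
Definition linking (K : fieldType) (r x s y : S1) : K :=
  let sigma := stereo (off_point [:: r; x; s; y]) in
  let sg a b := sgz (sigma a - sigma b) in
  2^-1 * (sg r x * sg r y * sg y x)%:~R
  - 2^-1 * (sg r x * sg r s * sg s x)%:~R.

End Circle.

Section GeneratedIdeal.
Variables (A : comNzRingType) (G : A -> Prop).

Definition gen_ideal : {pred A} := fun a =>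
  `[< exists2 s : seq (A * A), (forall c, c \in s -> G c.2)
      & a = \sum_(c <- s) c.1 * c.2 >].

Lemma gen_ideal_closed : 1 \notin gen_ideal -> idealr_closed gen_ideal.
Proof.
move=> h1; split=> //; first by apply/asboolP; exists [::]; rewrite ?big_nil.
move=> a u v /asboolP[s Gs ->] /asboolP[t Gt ->]; apply/asboolP.
exists ([seq (a * c.1, c.2) | c <- s] ++ t).
  by move=> c; rewrite mem_cat => /orP[/mapP[d /Gs Gd ->]|/Gt].
rewrite big_cat big_map mulr_sumr /=; congr (_ + _).
by apply: eq_bigr => c _; rewrite mulrA.
Qed.

Lemma gen_ideal_morph0 (B : comNzRingType) (f : {rmorphism A -> B}) :
  (forall a, G a -> f a = 0) -> forall a, a \in gen_ideal -> f a = 0.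
Proof.
move=> f0 a /asboolP[s Gs ->]; rewrite rmorph_sum big_seq big1 // => c /Gs Gc.
by rewrite rmorphM (f0 _ Gc) mulr0.
Qed.

End GeneratedIdeal.

Section SwappingAlgebra.
Variables (K : fieldType) (T : finType).

(* K[{xy}]: the variables are indexed by the ordered pairs of points. *)
Definition pairpoly := {mpoly K[#|{: T * T}|]}.
HB.instance Definition _ := GRing.ComNzRing.on pairpoly.

Definition pairvar (x y : T) : pairpoly := 'X_(enum_rank (x, y)).

Definition diag_ideal : {pred pairpoly} :=
  gen_ideal (fun a => exists x, a = pairvar x x).

Definition ev0 : pairpoly -> K := meval (fun=> 0).
HB.instance Definition _ := GRing.RMorphism.on ev0.

Lemma ev0_var x y : ev0 (pairvar x y) = 0.
Proof. by rewrite /ev0 mevalXU. Qed.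

Lemma ev0_diag a : a \in diag_ideal -> ev0 a = 0.
Proof. by apply: gen_ideal_morph0 => _ [x ->]; apply: ev0_var. Qed.

Fact diag_proper : 1 \notin diag_ideal.
Proof. by apply/negP => /ev0_diag /eqP; rewrite rmorph1 oner_eq0. Qed.

HB.instance Definition _ :=
  isIdealr.Build pairpoly diag_ideal (gen_ideal_closed diag_proper).

Definition swapZ := {ideal_quot diag_ideal}.
HB.instance Definition _ := GRing.ComNzRing.on swapZ.

Definition piZ : pairpoly -> swapZ := \pi_({ideal_quot diag_ideal}).
HB.instance Definition _ := GRing.RMorphism.on piZ.

Definition zpair (x y : T) : swapZ := piZ (pairvar x y).

Definition Delta (d : nat) (x y : 'I_d -> T) : swapZ :=
  \det (\matrix_(i, j) zpair (x i) (y j)).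

Definition Rn (n : nat) : {pred swapZ} :=
  gen_ideal (fun a => exists x y : 'I_n.+1 -> T, a = Delta x y).

Lemma piZK (u : swapZ) : piZ (repr u) = u.
Proof. exact: reprK. Qed.

Lemma piZ_eq (f g : pairpoly) : (piZ f == piZ g) = (f - g \in diag_ideal).
Proof. by rewrite /piZ Quotient.idealrBE. Qed.

Definition ev0Z (u : swapZ) : K := ev0 (repr u).

Lemma ev0Z_pi f : ev0Z (piZ f) = ev0 f.
Proof.
apply/eqP; rewrite -subr_eq0 -rmorphB; apply/eqP/ev0_diag.
by rewrite -piZ_eq piZK.
Qed.

Fact ev0Z_additive : zmod_morphism ev0Z.
Proof.
by move=> u v; rewrite -(piZK u) -(piZK v) -rmorphB !ev0Z_pi rmorphB.
Qed.
Fact ev0Z_multiplicative : monoid_morphism ev0Z.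
Proof.
split; first by rewrite -(rmorph1 piZ) ev0Z_pi rmorph1.
by move=> u v; rewrite -(piZK u) -(piZK v) -rmorphM !ev0Z_pi rmorphM.
Qed.
HB.instance Definition _ := GRing.isZmodMorphism.Build swapZ K ev0Z ev0Z_additive.
HB.instance Definition _ :=
  GRing.isMonoidMorphism.Build swapZ K ev0Z ev0Z_multiplicative.

Fact Rn_proper n : 1 \notin Rn n.
Proof.
apply/negP => h; have /eqP := oner_neq0 K; apply.
rewrite -(rmorph1 ev0Z); apply: gen_ideal_morph0 h => _ [x [y ->]].
rewrite -det_map_mx (_ : map_mx _ _ = 0) ?det0 //.
by apply/matrixP => i j; rewrite !mxE [LHS]ev0Z_pi ev0_var.
Qed.

HB.instance Definition _ n :=
  isIdealr.Build swapZ (Rn n) (gen_ideal_closed (@Rn_proper n)).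

Definition Zn (n : nat) := {ideal_quot Rn n}.
HB.instance Definition _ n := GRing.ComNzRing.on (Zn n).

Definition piZn n : swapZ -> Zn n := \pi_({ideal_quot Rn n}).
HB.instance Definition _ n := GRing.RMorphism.on (@piZn n).

End SwappingAlgebra.

Arguments diag_ideal K T : clear implicits.
Arguments Rn K T n : clear implicits.

Definition biderivation (A : nzRingType) (br : A -> A -> A) :=
  [/\ forall a b c, br (a + b) c = br a c + br b c,
      forall a b c, br c (a + b) = br c a + br c b,
      forall a b c, br (a * b) c = a * br b c + br a c * b
    & forall a b c, br c (a * b) = a * br c b + br c a * b].

Section SwappingBracket.
Variables (R : realType) (K : fieldType) (T : finType) (pos : T -> S1 R).
Local Notation J p q :=
  (linking K (pos p.1) (pos p.2) (pos q.1) (pos q.2)).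

(* The biderivation of K[{xy}] with {rx, sy} = J(rx, sy) ry sx. *)
Definition poly_bracket (f g : pairpoly K T) : pairpoly K T :=
  \sum_(p : T * T) \sum_(q : T * T)
    J p q *: (f^`M(enum_rank p) * g^`M(enum_rank q)
              * pairvar K p.1 q.2 * pairvar K q.1 p.2).

Definition swap_bracket (u v : swapZ K T) : swapZ K T :=
  piZ (poly_bracket (repr u) (repr v)).

Lemma linking_diagl (r s y : S1 R) : linking K r r s y = 0.
Proof. by rewrite /linking !subrr sgz0 !mul0r mulr0 subrr. Qed.

Lemma linking_diagr (r x s : S1 R) : linking K r x s s = 0.
Proof. by rewrite /linking subrr. Qed.

Lemma poly_bracketDl f g h :
  poly_bracket (f + g) h = poly_bracket f h + poly_bracket g h.
Proof.
rewrite -big_split; apply: eq_bigr => p _; rewrite -big_split.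
by apply: eq_bigr => q _; rewrite /= -scalerDr mderivD !mulrDl.
Qed.

Lemma poly_bracketDr f g h :
  poly_bracket h (f + g) = poly_bracket h f + poly_bracket h g.
Proof.
rewrite -big_split; apply: eq_bigr => p _; rewrite -big_split.
by apply: eq_bigr => q _; rewrite /= -scalerDr mderivD mulrDr !mulrDl.
Qed.

Lemma poly_bracketMl f g h :
  poly_bracket (f * g) h = f * poly_bracket g h + poly_bracket f h * g.
Proof.
rewrite mulr_sumr mulr_suml -big_split; apply: eq_bigr => p _.
rewrite mulr_sumr mulr_suml -big_split; apply: eq_bigr => q _.
by rewrite /= mderivM -scalerAl -scalerAr -scalerDr; congr (_ *: _); ring.
Qed.

Lemma poly_bracketMr f g h :
  poly_bracket h (f * g) = f * poly_bracket h g + poly_bracket h f * g.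
Proof.
rewrite mulr_sumr mulr_suml -big_split; apply: eq_bigr => p _.
rewrite mulr_sumr mulr_suml -big_split; apply: eq_bigr => q _.
by rewrite /= mderivM -scalerAl -scalerAr -scalerDr; congr (_ *: _); ring.
Qed.

Lemma mderiv_pairvar (p q : T * T) :
  (pairvar K p.1 p.2)^`M(enum_rank q) = (p == q)%:R.
Proof.
rewrite mderivX mnm1E -surjective_pairing (inj_eq enum_rank_inj).
case: eqVneq => [->|_]; last by rewrite scale0r.
rewrite scale1r (_ : (_ - _)%MM = 0%MM) ?mpolyX0 //.
by apply/mnmP => i; rewrite mnmBE mnm0E subnn.
Qed.

Lemma poly_bracket_gen r x s y :
  poly_bracket (pairvar K r x) (pairvar K s y) =
  linking K (pos r) (pos x) (pos s) (pos y)
    *: (pairvar K r y * pairvar K s x).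
Proof.
rewrite /poly_bracket (bigD1 (r, x)) //= (bigD1 (s, y)) //=.
rewrite !big1 ?addr0.
- by rewrite (mderiv_pairvar (r, x)) (mderiv_pairvar (s, y)) !eqxx !mul1r.
- move=> p /negPf np; rewrite big1 // => q _.
  by rewrite (mderiv_pairvar (r, x)) eq_sym np !mul0r scaler0.
- move=> q /negPf nq.
  by rewrite (mderiv_pairvar (s, y)) [_ == q]eq_sym nq mulr0 !mul0r scaler0.
Qed.

Lemma poly_bracket_diagl f g :
  f \in diag_ideal K T -> poly_bracket f g \in diag_ideal K T.
Proof.
move=> /asboolP[s Gs ->].
have sumE t : poly_bracket (\sum_(c <- t) c.1 * c.2) g = \sum_(c <- t) poly_bracket (c.1 * c.2) g.
  elim: t => [|c t ih]; last by rewrite !big_cons poly_bracketDl ih.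
  rewrite !big_nil /poly_bracket big1 // => p _; rewrite big1 // => q _.
  by rewrite mderiv0 !mul0r scaler0.
rewrite sumE big_seq; apply: rpred_sum => c /Gs [x cE].
rewrite poly_bracketMl rpredD //; last first.
  apply: idealMr; apply/asboolP; exists [:: (1, c.2)].
    by move=> d; rewrite inE => /eqP ->; exists x.
  by rewrite big_seq1 mul1r.
rewrite [poly_bracket _ _](_ : _ = 0) ?mulr0 ?rpred0 // cE.
rewrite /poly_bracket big1 // => p _; rewrite big1 // => q _.
rewrite (mderiv_pairvar (x, x)); case: eqVneq => [<-|_].
  by rewrite linking_diagl scale0r.
by rewrite !mul0r scaler0.
Qed.

Lemma poly_bracket_diagr f g :
  f \in diag_ideal K T -> poly_bracket g f \in diag_ideal K T.
Proof.
move=> /asboolP[s Gs ->].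
have sumE t : poly_bracket g (\sum_(c <- t) c.1 * c.2) = \sum_(c <- t) poly_bracket g (c.1 * c.2).
  elim: t => [|c t ih]; last by rewrite !big_cons poly_bracketDr ih.
  rewrite !big_nil /poly_bracket big1 // => p _; rewrite big1 // => q _.
  by rewrite mderiv0 mulr0 !mul0r scaler0.
rewrite sumE big_seq; apply: rpred_sum => c /Gs [x cE].
rewrite poly_bracketMr rpredD //; last first.
  apply: idealMr; apply/asboolP; exists [:: (1, c.2)].
    by move=> d; rewrite inE => /eqP ->; exists x.
  by rewrite big_seq1 mul1r.
rewrite [poly_bracket _ _](_ : _ = 0) ?mulr0 ?rpred0 // cE.
rewrite /poly_bracket big1 // => p _; rewrite big1 // => q _.
rewrite (mderiv_pairvar (x, x)); case: eqVneq => [<-|_].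
  by rewrite linking_diagr scale0r.
by rewrite mulr0 !mul0r scaler0.
Qed.

Lemma swap_bracket_pi f g :
  swap_bracket (piZ f) (piZ g) = piZ (poly_bracket f g).
Proof.
have e h : repr (piZ h) - h \in diag_ideal K T by rewrite -piZ_eq piZK.
apply/eqP; rewrite piZ_eq.
have := rpredD (poly_bracket_diagl (repr (piZ g)) (e f))
               (poly_bracket_diagr f (e g)).
set f' := repr (piZ f); set g' := repr (piZ g).
rewrite (_ : poly_bracket f' g' - poly_bracket f g
           = poly_bracket (f' - f) g' + poly_bracket f (g' - g)) //.
have -> : poly_bracket f' g' = poly_bracket (f' - f) g' + poly_bracket f g'.
  by rewrite -poly_bracketDl subrK.
have -> : poly_bracket f g' = poly_bracket f (g' - g) + poly_bracket f g.
  by rewrite -poly_bracketDr subrK.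
by rewrite addrA addrK.
Qed.

Lemma swap_bracket_biderivation : biderivation swap_bracket.
Proof.
split=> a b c; rewrite -(piZK a) -(piZK b) -(piZK c).
- by rewrite -rmorphD !swap_bracket_pi poly_bracketDl rmorphD.
- by rewrite -rmorphD !swap_bracket_pi poly_bracketDr rmorphD.
- by rewrite -rmorphM !swap_bracket_pi poly_bracketMl rmorphD !rmorphM.
- by rewrite -rmorphM !swap_bracket_pi poly_bracketMr rmorphD !rmorphM.
Qed.

Lemma swap_bracket_scalar (c : K) u :
  swap_bracket (piZ c%:MP) u = 0 /\ swap_bracket u (piZ c%:MP) = 0.
Proof.
rewrite -(piZK u) !swap_bracket_pi /poly_bracket.
split; rewrite big1 ?rmorph0 // => p _; rewrite big1 // => q _.
  by rewrite mderivC !mul0r scaler0.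
by rewrite mderivC mulr0 !mul0r scaler0.
Qed.

Lemma swap_bracket_gen r x s y :
  swap_bracket (zpair K r x) (zpair K s y) =
  piZ (linking K (pos r) (pos x) (pos s) (pos y))%:MP
    * zpair K r y * zpair K s x.
Proof.
by rewrite swap_bracket_pi poly_bracket_gen -mul_mpolyC !rmorphM mulrA.
Qed.

End SwappingBracket.

(* Q, with iota, is a field of fractions of A (which is therefore an integral
   domain). *)
Definition is_fraction_field (A : comNzRingType) (Q : fieldType)
    (iota : {rmorphism A -> Q}) :=
  injective iota /\
  forall q : Q, exists a b : A, b != 0 /\ q = iota a / iota b.

Section FractionField.
Variables (K : fieldType) (T : finType) (n : nat).
Variables (Q : fieldType) (iota : {rmorphism Zn K T n -> Q}).

Definition inQ (u : swapZ K T) : Q := iota (piZn n u).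

Definition constQ (c : K) : Q := inQ (piZ c%:MP).

Definition is_swapping_bracketQ (R : realType) (pos : T -> S1 R)
    (br : Q -> Q -> Q) :=
  biderivation br /\
  forall u v : swapZ K T, br (inQ u) (inQ v) = inQ (swap_bracket pos u v).

(* The subfield of Q generated over K by the elements satisfying G. *)
Definition gen_subfield (G : Q -> Prop) : {pred Q} := fun q =>
  `[< forall S : {pred Q}, divring_closed S -> (forall c, constQ c \in S) ->
        (forall g, G g -> g \in S) -> q \in S >].

Definition pair_ratio (y z x : T) : Q := inQ (zpair K y x) / inQ (zpair K z x).

Definition RT : {pred Q} :=
  gen_subfield (fun q => exists x y z, z != x /\ q = pair_ratio y z x).

(* E(x_1, ..., x_(n-1) | t, y) for xs = [:: x_1; ...; x_(n-1)], computed with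
   some choice of n distinct points v_1, ..., v_n (junk value 0 if there are
   fewer than n points).  As size xs = n - 1, the family i |-> nth t xs i is
   (x_1, ..., x_(n-1), t). *)
Definition detratio (xs : seq T) (t y : T) : Q :=
  if [pick v : n.-tuple T | uniq v] is Some v then
    inQ (Delta K (fun i : 'I_n => nth t xs i) (tnth v))
    / inQ (Delta K (fun i : 'I_n => nth y xs i) (tnth v))
  else 0.

End FractionField.

(* In P_(n-1) the point r_(k+1) is labelled by (r, k) with k : 'I_n.-1. *)
Section Copies.
Variables (K : fieldType) (T : finType) (n : nat) (hn : (2 <= n)%N).
Local Notation T' := (T * 'I_n.-1)%type.

Fact pred_gt0 : (0 < n.-1)%N. Proof. by case: n hn => [|[]]. Qed.

Definition copy1 (r : T) : T' := (r, Ordinal pred_gt0).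

Definition copies (r : T) : seq T' := [seq (r, k) | k <- enum 'I_n.-1].

Variables (Q : fieldType) (iota : {rmorphism Zn K T' n -> Q}).

Definition detratio_copies (x y z : T) : Q :=
  detratio iota (copies x) (copy1 y) (copy1 z).

Definition DR : {pred Q} :=
  gen_subfield iota
    (fun q => exists x y z, z != x /\ q = detratio_copies x y z).

End Copies.

(* Main.v *)
(* With respect to a fixed cut point o of the circle put
   e(a,b) = sgn(sigma b - sigma a).  Each orientation sign of a triple is
   e(a,b) + e(b,c) + e(c,a), whence
     J(rx,sy) = (e(r,s) + e(x,y) - e(r,y) - e(x,s)) / 2.
   Let M = (x_i v_j) and N = (a_k v_j) have the same columns.  Expanding
   {det M, det N} by cofactors, the column-column terms vanish, the mixed terms
   are multiples of det M or of det N which cancel in a bracket of ratios, and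
   there remains 1/2 sum_ik e(x_i,a_k) P_ik with
   P_ik = (M adj N)_ik (N adj M)_ki, a matrix whose rows and columns all sum to
   det M det N.  For rows x_1, ..., x_(n-1), y_1 and a_1, ..., a_(n-1), b_1, the
   sign e(x_i,a_k) depends only on the underlying points of P: two distinct
   copies of one point give P_ik = 0, because of a repeated row.  So only the
   corner P_nn survives, with the coefficient J(yx,ba) of the bracket {yx,ba}.
   No relation of rank n is needed. *)
Require Import Defs.
From HB Require Import structures.
From mathcomp Require Import all_boot all_order all_algebra.
From mathcomp Require Import boolp reals mpoly.
From mathcomp Require Import ring lra.

Set Implicit Arguments.
Unset Strict Implicit.
Unset Printing Implicit Defensive.

Import Order.TTheory GRing.Theory Num.Theory.
Local Open Scope ring_scope.

(** * Orientation signs on the circle and the linking number *)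

Section Orientation.
Variable R : realType.
Implicit Types o a b c r x s y : S1 R.

Definition cross a b : R := (val a).1 * (val b).2 - (val a).2 * (val b).1.

(** Twice the signed area of the triangle abc: its sign is the orientation of the triple, with no
    cut point involved. *)
Definition turn a b c : R := cross a b + cross b c + cross c a.

(* In the orthonormal frame (o, o rotated by a right angle), the coordinates of
   the point of stereographic projection t from o. *)
Definition stereo_inv (t : R) : R * R :=
  ((t ^+ 2 - 1) / (t ^+ 2 + 1), - (2 * t) / (t ^+ 2 + 1)).

Lemma sqr_add1_neq0 (t : R) : t ^+ 2 + 1 != 0.
Proof. by rewrite gt_eqF // ltr_wpDl // sqr_ge0. Qed.

(** The coordinates (u, w) of a in the frame of o satisfy u^2 + w^2 = 1, and u = 1 would force |a -
    o|^2 = 2 - 2u = 0. With t = - w / (1 - u) this gives t^2 + 1 = 2 / (1 - u), from which u and w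
    are recovered. *)
Lemma stereo_invP o a : a != o ->
  (val o).1 * (val a).1 + (val o).2 * (val a).2 = (stereo_inv (stereo o a)).1 /\
  cross o a = (stereo_inv (stereo o a)).2.
Proof.
move=> ao; rewrite /stereo_inv /stereo /cross /=.
case: o a ao => [[o1 o2] /= ho] [[a1 a2] /= ha]; rewrite -val_eqE /= => ao.
set u := o1 * a1 + _; set w := o1 * a2 - _.
have uw : u ^+ 2 + w ^+ 2 = 1.
  transitivity ((o1 ^+ 2 + o2 ^+ 2) * (a1 ^+ 2 + a2 ^+ 2)); first by rewrite /u /w; ring.
  by rewrite (eqP ho) (eqP ha) mulr1.
have u1 : 1 - u != 0.
  apply: contraNneq ao => /eqP; rewrite subr_eq0 => /eqP u1.
  have e0 : (a1 - o1) ^+ 2 + (a2 - o2) ^+ 2 == 0.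
    have -> : (a1 - o1) ^+ 2 + (a2 - o2) ^+ 2
      = (o1 ^+ 2 + o2 ^+ 2) + (a1 ^+ 2 + a2 ^+ 2) - 2 * u by rewrite /u; ring.
    by rewrite (eqP ho) (eqP ha) -u1 mulr1 subrr.
  move: e0; rewrite paddr_eq0 ?sqr_ge0 // !sqrf_eq0 !subr_eq0.
  by move=> /andP[/eqP -> /eqP ->].
have den : (- w / (1 - u)) ^+ 2 + 1 = 2 / (1 - u).
  have -> : (- w / (1 - u)) ^+ 2 + 1 = (w ^+ 2 + (1 - u) ^+ 2) / (1 - u) ^+ 2 by field.
  have -> : w ^+ 2 = 1 - u ^+ 2 by rewrite -uw; ring.
  by field.
have num : (- w / (1 - u)) ^+ 2 - 1 = 2 * u / (1 - u).
  rewrite (_ : _ - 1 = ((- w / (1 - u)) ^+ 2 + 1) - 2); last by ring.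
  by rewrite den; field.
by rewrite den num; split; field.
Qed.

Lemma cross_stereo o a b : a != o -> b != o ->
  cross a b = (stereo_inv (stereo o a)).1 * (stereo_inv (stereo o b)).2
            - (stereo_inv (stereo o a)).2 * (stereo_inv (stereo o b)).1.
Proof.
move=> /stereo_invP[<- <-] /stereo_invP[<- <-]; rewrite /cross.
transitivity (((val o).1 ^+ 2 + (val o).2 ^+ 2) * cross a b); last by rewrite /cross; ring.
by rewrite (eqP (valP o)) mul1r.
Qed.

(** In stereographic coordinates t, u, v the signed area is a positive multiple of (t - u)(u - v)(v
    - t). As [turn] does not mention o, the product of signs is the same for every cut point. *)
Lemma sgz_turn o a b c : a != o -> b != o -> c != o ->
  sgz (turn a b c) = sgz (stereo o a - stereo o b) * sgz (stereo o b - stereo o c)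
                     * sgz (stereo o c - stereo o a).
Proof.
move=> ao bo co; rewrite /turn !(@cross_stereo o) // -!sgzM.
move: (stereo o a) (stereo o b) (stereo o c) => t u v.
have t0 := sqr_add1_neq0 t; have u0 := sqr_add1_neq0 u; have v0 := sqr_add1_neq0 v.
rewrite /stereo_inv /=.
set lhs := (X in sgz X); set rhs := (X in _ = sgz X).
have -> : lhs = 4 / ((t ^+ 2 + 1) * (u ^+ 2 + 1) * (v ^+ 2 + 1)) * rhs.
  by rewrite /lhs /rhs; field; rewrite t0 u0 v0.
rewrite sgzM gtr0_sgz ?mul1r // divr_gt0 ?ltr0n //.
by rewrite !mulr_gt0 // ltr_wpDl // sqr_ge0.
Qed.

Definition esgn o a b : int := sgz (stereo o b - stereo o a).

Lemma esgnN o a b : esgn o a b = - esgn o b a.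
Proof. by rewrite /esgn -sgzN opprB. Qed.

Lemma esgnn o a : esgn o a a = 0.
Proof. by rewrite /esgn subrr sgz0. Qed.

(** Signs p, q, r of three reals with sum zero satisfy p + q + r = - p q r. *)
Lemma sgz_turn_sum o a b c : a != o -> b != o -> c != o ->
  sgz (turn a b c) = esgn o a b + esgn o b c + esgn o c a.
Proof.
move=> ao bo co; rewrite (@sgz_turn o) // /esgn.
move: (stereo o a) (stereo o b) (stereo o c) => t u v.
rewrite -(opprB t u) -(opprB u v) -(opprB v t) !sgzN.
by do 3!case: sgzP => ?; rewrite ?(mul0r, mulr0, mul1r, mulr1) //; exfalso; lra.
Qed.

(** Passing through [turn] moves both triple products from the cut point chosen in [linking] to o;
    the two terms e(r,x) then cancel in the difference. *)
Lemma linking_esgn (K : fieldType) o r x s y : o \notin [:: r; x; s; y] ->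
  linking K r x s y =
  2^-1 * (esgn o r s + esgn o x y - esgn o r y - esgn o x s)%:~R.
Proof.
rewrite /linking; set o' := off_point _; move=> oP.
have : o' \notin [:: r; x; s; y] := xchooseP (off_point_exists _).
rewrite !inE !negb_or ![o' == _]eq_sym => /and4P[r' x' s' y'].
move: oP; rewrite !inE !negb_or ![o == _]eq_sym => /and4P[r0 x0 s0 y0].
have E z : z != o -> z != o' ->
    sgz (stereo o' r - stereo o' x) * sgz (stereo o' r - stereo o' z)
      * sgz (stereo o' z - stereo o' x) = esgn o r x + esgn o x z + esgn o z r.
  move=> z0 z'; rewrite -(@sgz_turn_sum o) // (@sgz_turn o') //.
  rewrite -(opprB (stereo o' z) (stereo o' r)).
  by rewrite -(opprB (stereo o' z) (stereo o' x)) !sgzN; ring.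
rewrite !E // -mulrBr -rmorphB; congr (_ * _%:~R).
rewrite [esgn o y r]esgnN [esgn o s r]esgnN; ring.
Qed.

End Orientation.

(** * Derivations and biderivations on determinants and quotients *)

Section Derivation.
Variables (A : comNzRingType) (d : A -> A).
Hypotheses (dD : {morph d : a b / a + b}) (dM : forall a b, d (a * b) = a * d b + d a * b).

Lemma derivation0 : d 0 = 0.
Proof. by apply: (addIr (d 0)); rewrite -dD !add0r. Qed.

Lemma derivation1 : d 1 = 0.
Proof. by apply: (addIr (d 1)); rewrite add0r -[in RHS](mulr1 1) dM mulr1 mul1r. Qed.

Lemma derivationN a : d (- a) = - d a.
Proof. by apply: (addIr (d a)); rewrite -dD !addNr derivation0. Qed.

Lemma derivation_sum (I : Type) (r : seq I) (P : pred I) (F : I -> A) :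
  d (\sum_(i <- r | P i) F i) = \sum_(i <- r | P i) d (F i).
Proof. exact: (big_morph d dD derivation0). Qed.

Lemma derivation_sign (b : bool) a : d ((-1) ^+ b * a) = (-1) ^+ b * d a.
Proof. by case: b; rewrite ?mulN1r ?derivationN ?mul1r. Qed.

Lemma derivation_prod (I : finType) (F : I -> A) :
  d (\prod_i F i) = \sum_i \prod_j (if j == i then d (F j) else F j).
Proof.
(* The induction needs distinct indices: a repetition of i in the tail would be differentiated
   together with the head. *)
have E (r : seq I) : uniq r ->
    d (\prod_(i <- r) F i) = \sum_(i <- r) \prod_(j <- r) (if j == i then d (F j) else F j).
  elim: r => [_|i r ih /= /andP[ir ur]]; first by rewrite !big_nil derivation1.
  rewrite !big_cons dM ih // eqxx addrC; congr (_ * _ + _).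
    by apply: eq_big_seq => j jr; case: eqP jr ir => // ->  ->.
  rewrite mulr_sumr; apply: eq_big_seq => j jr.
  by rewrite big_cons; case: eqP jr ir => // -> ->.
by rewrite E ?index_enum_uniq.
Qed.

(** Jacobi's formula. [N i] differentiates row i alone, and expansion along that row leaves the
    cofactors of M. *)
Lemma derivation_det n (M : 'M[A]_n) :
  d (\det M) = \sum_i \sum_j d (M i j) * cofactor M i j.
Proof.
pose N i : 'M_n := \matrix_(k, l) (if k == i then d (M k l) else M k l).
transitivity (\sum_i \det (N i)).
  rewrite /determinant derivation_sum exchange_big; apply: eq_bigr => s _.
  rewrite derivation_sign derivation_prod mulr_sumr; apply: eq_bigr => i _.
  by congr (_ * _); apply: eq_bigr => j _; rewrite mxE.
apply: eq_bigr => i _; rewrite (expand_det_row _ i); apply: eq_bigr => j _.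
rewrite mxE eqxx /cofactor; congr (_ * (_ * \det _)).
by apply/matrixP => k l; rewrite !mxE eq_sym (negPf (neq_lift _ _)).
Qed.

End Derivation.

Section FieldDerivation.
Variables (F : fieldType) (d : F -> F).
Hypotheses (dD : {morph d : a b / a + b}) (dM : forall a b, d (a * b) = a * d b + d a * b).

Lemma derivationV a : d a^-1 = - (d a / a ^+ 2).
Proof.
have [->|a0] := eqVneq a 0; first by rewrite invr0 (derivation0 dD) mul0r oppr0.
have := dM a a^-1; rewrite divff // (derivation1 dM) => /eqP; rewrite eq_sym addr_eq0 => /eqP E.
by apply: (mulfI a0); rewrite E; field.
Qed.

Lemma derivation_div a b : d (a / b) = (d a * b - a * d b) / b ^+ 2.
Proof.
(* For b = 0 both sides are 0, by the convention that the inverse of 0 is 0. *)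
rewrite dM derivationV; have [->|b0] := eqVneq b 0; last by field.
by rewrite expr0n /= invr0 !mulr0 oppr0 mulr0 addr0.
Qed.

End FieldDerivation.

Section Biderivation.
Variables (F : fieldType) (br : F -> F -> F).
Hypothesis brP : biderivation br.

Lemma biderivation_l c : {morph br^~ c : a b / a + b} /\
  forall a b, br (a * b) c = a * br b c + br a c * b.
Proof. by case: brP => aD _ aM _; split=> [a b|a b]; rewrite ?aD ?aM. Qed.

Lemma biderivation_r c : {morph br c : a b / a + b} /\
  forall a b, br c (a * b) = a * br c b + br c a * b.
Proof. by case: brP => _ aD _ aM; split=> [a b|a b]; rewrite ?aD ?aM. Qed.

Lemma biderivation_div u1 u2 w1 w2 : br (u1 / u2) (w1 / w2) =
  (br u1 w1 * u2 * w2 - br u1 w2 * u2 * w1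
   - br u2 w1 * u1 * w2 + br u2 w2 * u1 * w1) / (u2 ^+ 2 * w2 ^+ 2).
Proof.
have [lD lM] := biderivation_l (w1 / w2).
rewrite (derivation_div lD lM).
have [D1 M1] := biderivation_r u1; have [D2 M2] := biderivation_r u2.
rewrite !(derivation_div D1 M1) (derivation_div D2 M2) invfM.
ring.
Qed.

Lemma biderivation_det n (M N : 'M[F]_n) : br (\det M) (\det N) =
  \sum_i \sum_k \sum_j \sum_l br (M i j) (N k l) * cofactor M i j * cofactor N k l.
Proof.
have [lD lM] := biderivation_l (\det N).
rewrite (derivation_det lD lM); apply: eq_bigr => i _.
rewrite exchange_big; apply: eq_bigr => j _ /=.
have [D M'] := biderivation_r (M i j).
rewrite (derivation_det D M') mulr_suml; apply: eq_bigr => k _.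
by rewrite mulr_suml; apply: eq_bigr => l _; ring.
Qed.

End Biderivation.
(* The shape shared by the brackets of two pairs and of two determinants; the
   terms in c, s, t, f and g cancel. *)
Lemma biderivation_ratio (F : fieldType) (br : F -> F -> F) (u1 u2 w1 w2 : F)
    (p1 p2 q1 q2 : F) (J11 J12 J21 J22 c s1 s2 t1 t2 f1 f2 g1 g2 : F) :
  biderivation br ->
  br u1 w1 = J11 * p1 * q1 + (c + s1 + t1) * u1 * w1 - f1 * w1 + g1 * u1 ->
  br u1 w2 = J12 * p1 * q2 + (c + s1 + t2) * u1 * w2 - f1 * w2 + g2 * u1 ->
  br u2 w1 = J21 * p2 * q1 + (c + s2 + t1) * u2 * w1 - f2 * w1 + g1 * u2 ->
  br u2 w2 = J22 * p2 * q2 + (c + s2 + t2) * u2 * w2 - f2 * w2 + g2 * u2 ->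
  br (u1 / u2) (w1 / w2) =
    J11 * (p1 / w2) * (q1 / u2) - J12 * (p1 / w2) * (q2 / u2) * (w1 / w2)
    - J21 * (p2 / w2) * (q1 / u2) * (u1 / u2)
    + J22 * (p2 / w2) * (q2 / u2) * (u1 / u2) * (w1 / w2).
Proof.
move=> brP E11 E12 E21 E22; rewrite (biderivation_div brP) E11 E12 E21 E22.
(* Every term on the right has one factor over u2 and one over w2, so both sides are 0 when a
   denominator vanishes. *)
have [->|u0] := eqVneq u2 0.
  by rewrite expr0n /= mul0r invr0 !(mulr0, mul0r) !subr0 addr0.
have [->|w0] := eqVneq w2 0; last first.
  by field; rewrite u0 w0.
by rewrite expr0n /= !mulr0 !invr0 !(mulr0, mul0r) !subr0 addr0.
Qed.

(** The coefficient is the constant exa, plus a correction on row L, one on column L and one at the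
    corner. The first three see only row and column sums, so the corner entry of P alone survives
    beside multiples of S. *)
Lemma sum_cross_weights (F : comNzRingType) (I : finType) (L : I) (P : I -> I -> F)
    (S eyb eya exb exa : F) :
  (forall i, \sum_k P i k = S) -> (forall k, \sum_i P i k = S) ->
  \sum_i \sum_k (if i == L then if k == L then eyb else eya
                 else if k == L then exb else exa) * P i k
  = (eyb + exa - eya - exb) * P L L + ((#|I|%:R - 2) * exa + eya + exb) * S.
Proof.
move=> rowP colP.
have delta (G : I -> F) : \sum_i (if i == L then G i else 0) = G L.
  by rewrite -big_mkcond big_pred1_eq.
have deltaL (G : I -> I -> F) :
    \sum_i \sum_k (if i == L then G i k else 0) = \sum_k G L k.
  by rewrite exchange_big; apply: eq_bigr => k _; rewrite (delta (G^~ k)).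
transitivity (\sum_i \sum_k (exa * P i k + (if i == L then (eya - exa) * P i k else 0)
  + (if k == L then (exb - exa) * P i k else 0)
  + (if i == L then if k == L then (eyb - eya - exb + exa) * P i k else 0 else 0))).
  apply: eq_bigr => i _; apply: eq_bigr => k _.
  by case: (i == L); case: (k == L); ring.
under eq_bigr do rewrite !big_split /= -mulr_sumr rowP delta.
rewrite !big_split /= sumr_const -mulr_sumr colP.
rewrite !deltaL delta -mulr_sumr rowP -[_ *+ _]mulr_natr; ring.
Qed.

(** * Row exchange weights and double cofactor sums of two matrices *)

Section DoubleCofactor.
Variables (F : comNzRingType) (n : nat) (M N : 'M[F]_n).

(* (N adj M)_ki is the determinant of M with row i replaced by row k of N, so
   this is the product of the two determinants after exchanging these rows. *)
Definition swap_weight (i k : 'I_n) : F := (M *m \adj N) i k * (N *m \adj M) k i.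

(** The sum is a diagonal entry of M (adj N) N (adj M), whose inner product is the scalar det N. *)
Lemma swap_weight_row i : \sum_k swap_weight i k = \det M * \det N.
Proof.
transitivity (((M *m \adj N) *m (N *m \adj M)) i i); first by rewrite [RHS]mxE.
by rewrite mulmxA -(mulmxA M) mul_adj_mx mul_mx_scalar -scalemxAl mul_mx_adj !mxE eqxx mulrC.
Qed.

Lemma swap_weight_col k : \sum_i swap_weight i k = \det M * \det N.
Proof.
transitivity (((N *m \adj M) *m (M *m \adj N)) k k).
  by rewrite [RHS]mxE; apply: eq_bigr => i _; rewrite /swap_weight mulrC.
by rewrite mulmxA -(mulmxA N) mul_adj_mx mul_mx_scalar -scalemxAl mul_mx_adj !mxE eqxx.
Qed.

(** Putting row i' of M in place of row i repeats a row, unless i' = i. *)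
Lemma mul_adj_row (i k i' : 'I_n) : row k N = row i' M -> (N *m \adj M) k i = \det M *+ (i' == i).
Proof.
move=> e; transitivity ((M *m \adj M) i' i); last by rewrite mul_mx_adj mxE.
rewrite !mxE; apply: eq_bigr => j _; congr (_ * _).
by move/rowP/(_ j): e; rewrite !mxE.
Qed.

(** Laplace expansion of M' along row i: the cofactors of that row do not see it, so they are those
    of M. *)
Lemma mul_adj_replace (i k : 'I_n) (M' : 'M_n) :
  row i M' = row k N -> row' i M' = row' i M -> (N *m \adj M) k i = \det M'.
Proof.
move=> er er'; rewrite mxE (expand_det_row _ i); apply: eq_bigr => j _.
have -> : N k j = M' i j by move/rowP/(_ j): er; rewrite !mxE.
rewrite mxE /cofactor; do 2!congr (_ * _); congr (\det _).
by apply/matrixP => a b; move/matrixP/(_ a (lift j b)): er'; rewrite !mxE.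
Qed.

(** The columns in [M i l * N k j] are exchanged, as in the swapping bracket. Summing over j and l
    produces the weights for e1. A column expanded by the cofactors of another column gives 0, so
    summing over a row index forces j = l: this kills e2, and reduces e3 and e4 to multiples of one
    determinant. *)
Lemma double_cofactor_sum (e1 e2 e3 e4 : 'I_n -> 'I_n -> F) :
  (forall j, e2 j j = 0) ->
  \sum_i \sum_k \sum_j \sum_l
    (e1 i k + e2 j l - e3 i l - e4 j k) * (M i l * N k j) * cofactor M i j * cofactor N k l
  = \sum_i \sum_k e1 i k * swap_weight i k
    - (\sum_i \sum_l e3 i l * M i l * cofactor M i l) * \det N
    - (\sum_k \sum_j e4 j k * N k j * cofactor N k j) * \det M.
Proof.
move=> e20.
have colE (A : 'M[F]_n) (j l : 'I_n) : \sum_i A i l * cofactor A i j = \det A *+ (j == l).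
  transitivity ((\adj A *m A) j l); last by rewrite mul_adj_mx mxE.
  by rewrite mxE; apply: eq_bigr => i _; rewrite mxE mulrC.
have S1 : \sum_i \sum_k \sum_j \sum_l e1 i k * (M i l * N k j * cofactor M i j * cofactor N k l)
    = \sum_i \sum_k e1 i k * swap_weight i k.
  apply: eq_bigr => i _; apply: eq_bigr => k _; rewrite exchange_big.
  rewrite /swap_weight !mxE big_distrlr mulr_sumr; apply: eq_bigr => l _ /=.
  by rewrite mulr_sumr; apply: eq_bigr => j _; rewrite !mxE; ring.
have S2 : \sum_i \sum_k \sum_j \sum_l e2 j l * (M i l * N k j * cofactor M i j * cofactor N k l)
    = 0.
  under eq_bigr do rewrite exchange_big.
  rewrite exchange_big big1 // => j _; under eq_bigr do rewrite exchange_big.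
  rewrite exchange_big big1 // => l _.
  transitivity (e2 j l * ((\sum_i M i l * cofactor M i j) * (\sum_k N k j * cofactor N k l))).
    rewrite big_distrlr mulr_sumr; apply: eq_bigr => i _ /=.
    by rewrite mulr_sumr; apply: eq_bigr => k _; ring.
  rewrite colE; have [->|_] := eqVneq j l; first by rewrite e20 mul0r.
  by rewrite mul0r mulr0.
have S3 : \sum_i \sum_k \sum_j \sum_l e3 i l * (M i l * N k j * cofactor M i j * cofactor N k l)
    = (\sum_i \sum_l e3 i l * M i l * cofactor M i l) * \det N.
  rewrite mulr_suml; apply: eq_bigr => i _.
  under eq_bigr do rewrite exchange_big.
  rewrite exchange_big mulr_suml; apply: eq_bigr => l _ /=.
  transitivity (\sum_j e3 i l * M i l * cofactor M i j * (\sum_k N k j * cofactor N k l)).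
    rewrite exchange_big; apply: eq_bigr => j _ /=.
    by rewrite mulr_sumr; apply: eq_bigr => k _; ring.
  rewrite (bigD1 l) //= colE eqxx big1 ?addr0 // => j /negPf jl.
  by rewrite colE eq_sym jl mulr0.
have S4 : \sum_i \sum_k \sum_j \sum_l e4 j k * (M i l * N k j * cofactor M i j * cofactor N k l)
    = (\sum_k \sum_j e4 j k * N k j * cofactor N k j) * \det M.
  rewrite exchange_big mulr_suml; apply: eq_bigr => k _.
  rewrite exchange_big mulr_suml; apply: eq_bigr => j _ /=.
  transitivity (\sum_l e4 j k * N k j * cofactor N k l * (\sum_i M i l * cofactor M i j)).
    rewrite exchange_big; apply: eq_bigr => l _ /=.
    by rewrite mulr_sumr; apply: eq_bigr => i _; ring.
  rewrite (bigD1 j) //= colE eqxx big1 ?addr0 // => l /negPf jl.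
  by rewrite colE eq_sym jl mulr0.
rewrite -S1 -S3 -S4 -[RHS]addr0 -[X in _ = _ + X]S2 -!sumrN -!big_split; apply: eq_bigr => i _.
rewrite -!sumrN -!big_split; apply: eq_bigr => k _.
rewrite -!sumrN -!big_split; apply: eq_bigr => j _.
rewrite -!sumrN -!big_split; apply: eq_bigr => l _ /=.
ring.
Qed.

End DoubleCofactor.

(** * Constants, determinants and generated subfields in the field of fractions *)

Section Constants.
Variables (K : fieldType) (T : finType) (n : nat).
Variables (Q : fieldType) (iota : {rmorphism Zn K T n -> Q}).

HB.instance Definition _ := GRing.RMorphism.copy (inQ iota) (iota \o @piZn K T n).
HB.instance Definition _ :=
  GRing.RMorphism.copy (constQ iota) (inQ iota \o @piZ K T \o @mpolyC #|{: T * T}| K).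

Lemma inQ_Delta d (x y : 'I_d -> T) :
  inQ iota (Delta K x y) = \det (\matrix_(i, j) inQ iota (zpair K (x i) (y j))).
Proof.
by rewrite /Delta -det_map_mx; congr (\det _); apply/matrixP => i j; rewrite !mxE.
Qed.

Lemma fraction_inQ : is_fraction_field iota -> forall q, exists u v, q = inQ iota u / inQ iota v.
Proof.
move=> [_ frac] q; have [a [b [_ ->]]] := frac q.
by exists (repr a), (repr b); rewrite /inQ /piZn !reprK.
Qed.

Lemma gen_subfield_closed (G : Q -> Prop) : divring_closed (gen_subfield iota G).
Proof.
split=> [|f g /asboolP hf /asboolP hg|f g /asboolP hf /asboolP hg]; apply/asboolP => S Scl Sc SG.
- by case: Scl.
- by case: (Scl) => _ + _; apply; [apply: hf|apply: hg].
- by case: (Scl) => _ _; apply; [apply: hf|apply: hg].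
Qed.

Lemma gen_subfield_const (G : Q -> Prop) c : constQ iota c \in gen_subfield iota G.
Proof. by apply/asboolP => S _ + _; apply. Qed.

Lemma gen_subfield_gen (G : Q -> Prop) g : G g -> g \in gen_subfield iota G.
Proof. by move=> Gg; apply/asboolP => S _ _; apply. Qed.

End Constants.

(** * The swapping bracket of pair ratios and of determinants *)

Section SwappingQ.
Variables (R : realType) (K : fieldType) (T : finType) (n : nat) (pos : T -> S1 R).
Variables (Q : fieldType) (iota : {rmorphism Zn K T n -> Q}) (br : Q -> Q -> Q).
Hypothesis swapQ : is_swapping_bracketQ iota pos br.

Local Notation w x y := (inQ iota (zpair K x y)).
Local Notation J r x s y := (constQ iota (linking K (pos r) (pos x) (pos s) (pos y))).

Lemma bracketQ_pair r x s y : br (w r x) (w s y) = J r x s y * w r y * w s x.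
Proof. by case: swapQ => _ ->; rewrite swap_bracket_gen !rmorphM. Qed.

(** A biderivation is not linear over K by definition. Constants are killed in the swapping algebra,
    and the quotient rule carries this to all fractions. *)
Lemma bracketQ_const (c : K) : is_fraction_field iota ->
  forall q, br (constQ iota c) q = 0 /\ br q (constQ iota c) = 0.
Proof.
move=> frac q; have [u [v ->]] := fraction_inQ frac q.
have [bi inE] := swapQ.
have [c1 M1] := biderivation_l bi (inQ iota u / inQ iota v).
have [c2 M2] := biderivation_r bi (constQ iota c).
have [c3 M3] := biderivation_l bi (constQ iota c).
rewrite (derivation_div c2 M2) (derivation_div c3 M3) /constQ !inE.
have sc := swap_bracket_scalar pos c.
by rewrite !(sc _).1 !(sc _).2 !rmorph0 !(mul0r, mulr0) subrr mul0r.
Qed.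

Lemma bracketQ_pair_ratio x y z a b c : br (pair_ratio iota y z x) (pair_ratio iota b c a) =
  J y x b a * pair_ratio iota y c a * pair_ratio iota b z x
  - J y x c a * pair_ratio iota y c a * pair_ratio iota c z x * pair_ratio iota b c a
  - J z x b a * pair_ratio iota z c a * pair_ratio iota b z x * pair_ratio iota y z x
  + J z x c a * pair_ratio iota z c a * pair_ratio iota c z x * pair_ratio iota y z x
      * pair_ratio iota b c a.
Proof.
rewrite /pair_ratio; case: (swapQ) => bi _.
by apply: (biderivation_ratio (c := 0) (s1 := 0) (s2 := 0) (t1 := 0) (t2 := 0)
  (f1 := 0) (f2 := 0) (g1 := 0) (g2 := 0) bi); rewrite bracketQ_pair; ring.
Qed.

Variable (o : S1 R).
Hypothesis (ho : forall t, pos t != o).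

Definition esgnQ (a b : T) : Q := (esgn o (pos a) (pos b))%:~R.

Lemma esgnQN a b : esgnQ a b = - esgnQ b a.
Proof. by rewrite /esgnQ esgnN rmorphN. Qed.

Lemma esgnQn a : esgnQ a a = 0.
Proof. by rewrite /esgnQ esgnn. Qed.

Lemma linkingQ r x s y :
  J r x s y = constQ iota 2^-1 * (esgnQ r s + esgnQ x y - esgnQ r y - esgnQ x s).
Proof.
rewrite (@linking_esgn _ _ o) ?rmorphM ?rmorph_int ?rmorphB ?rmorphD //.
by rewrite !inE ![o == _]eq_sym !negb_or !ho.
Qed.

Definition pair_mx d (x v : 'I_d -> T) : 'M[Q]_d := \matrix_(i, j) w (x i) (v j).

Lemma bracketQ_det d (x a v : 'I_d -> T) (phi := fun x : 'I_d -> T =>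
    constQ iota 2^-1 *
    (\sum_i \sum_l esgnQ (x i) (v l) * pair_mx x v i l * cofactor (pair_mx x v) i l)) :
  br (\det (pair_mx x v)) (\det (pair_mx a v)) =
  constQ iota 2^-1 * (\sum_i \sum_k esgnQ (x i) (a k) * swap_weight (pair_mx x v) (pair_mx a v) i k)
  - phi x * \det (pair_mx a v) + phi a * \det (pair_mx x v).
Proof.
case: (swapQ) => bi _; rewrite (biderivation_det bi).
pose e4 j k := esgnQ (v j) (a k).
have D := @double_cofactor_sum _ d (pair_mx x v) (pair_mx a v) (fun i k => esgnQ (x i) (a k))
  (fun j l => esgnQ (v j) (v l)) (fun i l => esgnQ (x i) (v l)) e4 (fun j => esgnQn (v j)).
transitivity (constQ iota 2^-1 *
   (\sum_i \sum_k esgnQ (x i) (a k) * swap_weight (pair_mx x v) (pair_mx a v) i k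
    - (\sum_i \sum_l esgnQ (x i) (v l) * pair_mx x v i l * cofactor (pair_mx x v) i l)
      * \det (pair_mx a v)
    - (\sum_k \sum_j e4 j k * pair_mx a v k j * cofactor (pair_mx a v) k j) * \det (pair_mx x v))).
  rewrite -D mulr_sumr; apply: eq_bigr => i _; rewrite mulr_sumr; apply: eq_bigr => k _.
  rewrite mulr_sumr; apply: eq_bigr => j _; rewrite mulr_sumr; apply: eq_bigr => l _.
  by rewrite !mxE bracketQ_pair linkingQ; rewrite /e4; ring.
(* Antisymmetry of e turns the mixed term of the second matrix into [- phi a], so both mixed terms
   come from one function of the rows and cancel in ratios. *)
have -> : \sum_k \sum_j e4 j k * pair_mx a v k j * cofactor (pair_mx a v) k j
    = - \sum_i \sum_l esgnQ (a i) (v l) * pair_mx a v i l * cofactor (pair_mx a v) i l.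
  rewrite -sumrN; apply: eq_bigr => k _; rewrite -sumrN; apply: eq_bigr => j _.
  by rewrite /e4 esgnQN !mulNr.
by rewrite /phi; ring.
Qed.

End SwappingQ.

(** * The row families x_1, ..., x_(n-1), y_1 *)

Section CopyRow.
Variables (T : finType) (n : nat) (hn : (2 <= n)%N).

Fact last_row_subproof : (n.-1 < n)%N. Proof. by rewrite prednK // (ltnW hn). Qed.
Definition last_row : 'I_n := Ordinal last_row_subproof.

Fact first_row_subproof : (0 < n)%N. Proof. exact: ltnW. Qed.
Definition first_row : 'I_n := Ordinal first_row_subproof.

(** [copies n x] has n - 1 entries, so the last index falls on the default value y_1 of [nth]. *)
Definition copy_row (x y : T) (i : 'I_n) : T * 'I_n.-1 := nth (copy1 hn y) (copies n x) i.

Lemma first_neq_last : first_row != last_row.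
Proof. by rewrite -val_eqE /= eq_sym -lt0n -subn1 subn_gt0. Qed.

Lemma neq_last_row i : (i != last_row) = (i < n.-1)%N.
Proof.
by rewrite -val_eqE /= ltn_neqAle -ltnS prednK ?ltn_ord ?andbT // (ltnW hn).
Qed.

Lemma size_copies (x : T) : size (copies n x) = n.-1.
Proof. by rewrite size_map size_enum_ord. Qed.

Lemma copy_row_last x y : copy_row x y last_row = copy1 hn y.
Proof. by rewrite /copy_row nth_default // size_copies. Qed.

Lemma copy_rowP x y (i : 'I_n) (li : (i < n.-1)%N) : copy_row x y i = (x, Ordinal li).
Proof.
rewrite /copy_row (nth_map (Ordinal li)) ?size_enum_ord //; congr pair.
by apply/val_inj; rewrite /= nth_enum_ord.
Qed.

Lemma copy_row_neq x y y' i : i != last_row -> copy_row x y i = copy_row x y' i.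
Proof. by rewrite neq_last_row => li; rewrite !copy_rowP. Qed.

Lemma copy_row_first x y : copy_row x y first_row = copy1 hn x.
Proof.
have l0 : (first_row < n.-1)%N by rewrite -neq_last_row first_neq_last.
by rewrite copy_rowP; congr pair; apply/val_inj.
Qed.

Lemma copy_row1 x y i : (copy_row x y i).1 = if i == last_row then y else x.
Proof.
case: eqVneq => [->|]; first by rewrite copy_row_last.
by rewrite neq_last_row => li; rewrite copy_rowP.
Qed.

End CopyRow.

(** * The bracket of determinant ratios of copies *)

Section CopyBracket.
Variables (R : realType) (K : fieldType) (T : finType) (n : nat) (hn : (2 <= n)%N).
Local Notation T' := (T * 'I_n.-1)%type.
Variables (pos : T' -> S1 R) (Q : fieldType) (iota : {rmorphism Zn K T' n -> Q}).
Variables (br : Q -> Q -> Q) (o : S1 R) (e : T -> T -> int).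
Hypotheses (swapQ : is_swapping_bracketQ iota pos br) (ho : forall t, pos t != o).
Hypothesis he : forall i j k l, i != j -> esgn o (pos (i, k)) (pos (j, l)) = e i j.
Hypothesis e0 : forall i, e i i = 0.

Local Notation L := (last_row hn).
Local Notation mx v x y := (pair_mx iota (copy_row hn x y) v).

Lemma row_pair_mx d (x a v : 'I_d -> T') i k : x i = a k ->
  row i (pair_mx iota x v) = row k (pair_mx iota a v).
Proof. by move=> xa; apply/rowP => j; rewrite !mxE xa. Qed.

(** Only rows lying over one point of P need an argument. There the right side vanishes by [e0]; on
    the left the sign is 0 for equal copies and the weight is 0 for distinct ones. *)
Lemma esgnQ_swap_weight v x y a b i k :
  esgnQ pos Q o (copy_row hn x y i) (copy_row hn a b k)
    * swap_weight (mx v x y) (mx v a b) i k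
  = (if i == L then if k == L then (e y b)%:~R else (e y a)%:~R
     else if k == L then (e x b)%:~R else (e x a)%:~R)
    * swap_weight (mx v x y) (mx v a b) i k.
Proof.
have [eq1|ne1] := eqVneq (copy_row hn x y i).1 (copy_row hn a b k).1; last first.
  congr (_ * _); rewrite /esgnQ [copy_row _ x _ _]surjective_pairing.
  rewrite [copy_row _ a _ _]surjective_pairing he // !copy_row1.
  by case: (i == L); case: (k == L).
have -> : (if i == L then if k == L then (e y b)%:~R else (e y a)%:~R
     else if k == L then (e x b)%:~R else (e x a)%:~R) = 0 :> Q.
  by move: eq1; rewrite !copy_row1; case: (i == L); case: (k == L) => ->; rewrite e0.
rewrite mul0r.
have [eq2|ne2] := eqVneq (copy_row hn x y i) (copy_row hn a b k).
  by rewrite eq2 esgnQn mul0r.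
suff -> : swap_weight (mx v x y) (mx v a b) i k = 0 by rewrite mulr0.
have repeatN i' : i' != i -> copy_row hn a b k = copy_row hn x y i' ->
    swap_weight (mx v x y) (mx v a b) i k = 0.
  move=> /negPf ii' r; rewrite /swap_weight (mul_adj_row i (row_pair_mx v r)) ii'.
  exact: mulr0.
have repeatM k' : k' != k -> copy_row hn x y i = copy_row hn a b k' ->
    swap_weight (mx v x y) (mx v a b) i k = 0.
  move=> /negPf kk' r; rewrite /swap_weight (mul_adj_row k (row_pair_mx v r)) kk'.
  exact: mul0r.
move: eq1; rewrite !copy_row1.
(* If i and k are both last, the copies coincide. If only i is last, y_1 = a_1 already heads the
   second family; if only k is last, b_1 = x_1 heads the first. Otherwise x = a and the two families
   share their row k. *)
case: (eqVneq i L) ne2 repeatN repeatM => [->|iL]; case: (eqVneq k L) => [->|kL].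
- by rewrite !copy_row_last => + _ _ => /eqP + E; rewrite E.
- move=> ne2 _ repeatM ya; apply: (repeatM (first_row hn)).
    by apply: contraNneq ne2 => <-; rewrite copy_row_last copy_row_first ya.
  by rewrite copy_row_last copy_row_first ya.
- move=> ne2 repeatN _ xb; apply: (repeatN (first_row hn)).
    by apply: contraNneq ne2 => <-; rewrite copy_row_last copy_row_first xb.
  by rewrite copy_row_last copy_row_first xb.
- move=> ne2 repeatN _ xa; rewrite xa in ne2 repeatN *.
  apply: (repeatN k); last exact: copy_row_neq.
  by apply: contraNneq ne2 => ->; rewrite (copy_row_neq a y b iL).
Qed.

Lemma mul_adj_last v x y a b : (mx v a b *m \adj (mx v x y)) L L = \det (mx v x b).
Proof.
apply: mul_adj_replace; first by apply: row_pair_mx; rewrite !copy_row_last.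
apply/matrixP => i j; rewrite !mxE.
by rewrite (copy_row_neq x b y) // eq_sym neq_lift.
Qed.

Definition phi v x y := constQ iota 2^-1 * (\sum_i \sum_l
  esgnQ pos Q o (copy_row hn x y i) (v l) * mx v x y i l * cofactor (mx v x y) i l).

(** The coefficient of the product of the two determinants splits into terms in (x,a), (y,a) and
    (x,b). These are c, s and t of [biderivation_ratio]: none of them involves both y and b. *)
Lemma bracketQ_copies v x y a b :
  br (\det (mx v x y)) (\det (mx v a b)) =
  constQ iota 2^-1 * (e y b + e x a - e y a - e x b)%:~R
    * \det (mx v a y) * \det (mx v x b)
  + (constQ iota 2^-1 * (n%:R - 2) * (e x a)%:~R + constQ iota 2^-1 * (e y a)%:~R
     + constQ iota 2^-1 * (e x b)%:~R) * \det (mx v x y) * \det (mx v a b)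
  - phi v x y * \det (mx v a b) + phi v a b * \det (mx v x y).
Proof.
rewrite (bracketQ_det swapQ ho) -!/(phi _ _ _).
under eq_bigr do under eq_bigr do rewrite esgnQ_swap_weight.
rewrite (@sum_cross_weights _ _ _ _ (\det (mx v x y) * \det (mx v a b))) ?card_ord;
  [|exact: swap_weight_row|exact: swap_weight_col].
rewrite /swap_weight !mul_adj_last !rmorphB rmorphD /=; ring.
Qed.

Lemma bracketQ_detratio x y z a b c :
  br (detratio_copies hn iota x y z) (detratio_copies hn iota a b c) =
  let J y x b a := constQ iota 2^-1 * (e y b + e x a - e y a - e x b)%:~R in
  let E := detratio_copies hn iota in
  J y x b a * E a y c * E x b z - J y x c a * E a y c * E x c z * E a b c
  - J z x b a * E a z c * E x b z * E x y z
  + J z x c a * E a z c * E x c z * E x y z * E a b c.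
Proof.
have [bi _] := swapQ.
(* All ratios use the same columns v. If n distinct points do not exist, all ratios are 0 and so are
   both sides. *)
rewrite /= /detratio_copies /detratio; case: pickP => [v _|_]; last first.
  by rewrite (derivation0 (proj1 (biderivation_l bi 0))) !mulr0 !subr0 addr0.
rewrite !inQ_Delta; pose w := tnth v.
exact: (biderivation_ratio bi (bracketQ_copies w x y a b) (bracketQ_copies w x y a c)
  (bracketQ_copies w x z a b) (bracketQ_copies w x z a c)).
Qed.

End CopyBracket.

(** * Maps that are ring morphisms on a subfield only *)

Section SubfieldMorphism.
Variables (F F' : fieldType) (A : {pred F}) (mu : F -> F').
Hypotheses (Acl : divring_closed A) (mu1 : mu 1 = 1).
Hypotheses (muD : {in A &, {morph mu : f g / f + g}}).
Hypotheses (muM : {in A &, {morph mu : f g / f * g}}).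

Lemma subfield1 : 1 \in A. Proof. by case: Acl. Qed.
Lemma subfieldB f g : f \in A -> g \in A -> f - g \in A.
Proof. by case: Acl => _ + _; apply. Qed.
Lemma subfield_div f g : f \in A -> g \in A -> f / g \in A.
Proof. by case: Acl => _ _; apply. Qed.
Lemma subfield0 : 0 \in A. Proof. by rewrite -(subrr 1) subfieldB ?subfield1. Qed.
Lemma subfieldN f : f \in A -> - f \in A.
Proof. by rewrite -sub0r; apply/subfieldB/subfield0. Qed.
Lemma subfieldD f g : f \in A -> g \in A -> f + g \in A.
Proof. by move=> fA gA; rewrite -[g]opprK subfieldB ?subfieldN. Qed.
Lemma subfieldV f : f \in A -> f^-1 \in A.
Proof. by rewrite -div1r; apply/subfield_div/subfield1. Qed.
Lemma subfieldM f g : f \in A -> g \in A -> f * g \in A.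
Proof. by move=> fA gA; rewrite -[g]invrK subfield_div ?subfieldV. Qed.

Lemma submorph0 : mu 0 = 0.
Proof. by apply: (addIr (mu 0)); rewrite -muD ?subfield0 // !add0r. Qed.

Lemma submorphN f : f \in A -> mu (- f) = - mu f.
Proof.
by move=> fA; apply: (addIr (mu f)); rewrite -muD ?subfieldN // !addNr submorph0.
Qed.

Lemma submorphB f g : f \in A -> g \in A -> mu (f - g) = mu f - mu g.
Proof. by move=> fA gA; rewrite muD ?subfieldN // submorphN. Qed.

Lemma submorphV f : f \in A -> mu f^-1 = (mu f)^-1.
Proof.
have [->|f0] := eqVneq f 0; first by rewrite invr0 submorph0 invr0.
move=> fA; have E : mu f * mu f^-1 = 1 by rewrite -muM ?subfieldV // divff.
have mf0 : mu f != 0 by apply: contra_eq_neq E => ->; rewrite mul0r eq_sym oner_eq0.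
by apply: (mulfI mf0); rewrite E divff.
Qed.

Lemma submorph_ratio (J11 J12 J21 J22 p1 p2 q1 q2 r s : F) :
  J11 \in A -> J12 \in A -> J21 \in A -> J22 \in A ->
  p1 \in A -> p2 \in A -> q1 \in A -> q2 \in A -> r \in A -> s \in A ->
  J11 * p1 * q1 - J12 * p1 * q2 * s - J21 * p2 * q1 * r + J22 * p2 * q2 * r * s \in A /\
  mu (J11 * p1 * q1 - J12 * p1 * q2 * s - J21 * p2 * q1 * r + J22 * p2 * q2 * r * s) =
  mu J11 * mu p1 * mu q1 - mu J12 * mu p1 * mu q2 * mu s
  - mu J21 * mu p2 * mu q1 * mu r + mu J22 * mu p2 * mu q2 * mu r * mu s.
Proof.
move=> *; rewrite !(submorphB, muD, muM);
by repeat (done || apply: subfieldB || apply: subfieldD || apply: subfieldM || split).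
Qed.

(** This reduces compatibility with a derivation to generators. Membership of [d f] in A is carried
    along because mu is controlled only on A. *)
Lemma derivation_submorph_closed (d : F -> F) (d' : F' -> F') :
  {morph d : a b / a + b} -> (forall a b, d (a * b) = a * d b + d a * b) ->
  {morph d' : a b / a + b} -> (forall a b, d' (a * b) = a * d' b + d' a * b) ->
  divring_closed [pred f | [&& f \in A, d f \in A & mu (d f) == d' (mu f)]].
Proof.
move=> dD dM dD' dM'; split=> [|f g|f g].
- by rewrite inE subfield1 (derivation1 dM) subfield0 mu1 (derivation1 dM') submorph0 /=.
- rewrite !inE => /and3P[fA dfA /eqP fE] /and3P[gA dgA /eqP gE].
  rewrite dD (derivationN dD) !submorphB // dD' (derivationN dD').
  by rewrite !subfieldB // fE gE eqxx.
- rewrite !inE => /and3P[fA dfA /eqP fE] /and3P[gA dgA /eqP gE].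
  rewrite !(derivation_div dD dM) subfield_div //=.
  have a1 := subfieldM dfA gA; have a2 := subfieldM fA dgA.
  have a3 := subfieldM gA gA; have a4 := subfieldB a1 a2.
  have a5 := subfieldV a3; have a6 := subfieldV gA.
  rewrite subfield_div //= !muM // !submorphV // submorphB // !muM // fE gE.
  by rewrite (derivation_div dD' dM') eqxx.
Qed.

End SubfieldMorphism.

Lemma gen_subfield_sub (K : fieldType) (T : finType) (n : nat) (Q : fieldType)
    (iota : {rmorphism Zn K T n -> Q}) (G : Q -> Prop) (S : {pred Q}) :
  divring_closed S -> (forall c, constQ iota c \in S) -> (forall g, G g -> g \in S) ->
  {subset gen_subfield iota G <= S}.
Proof. by move=> Scl Sc SG q /asboolP; apply. Qed.

(** * Signs read off from an anticlockwise list *)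

Section CutPoint.
Variable R : realType.

(** It extracts the comparisons between different blocks, that is, between copies of different
    points. *)
Lemma pairwise_allpairs (I J A : Type) (r : rel A) (f : I -> J -> A) s t :
  pairwise r [seq f i k | i <- s, k <- t] ->
  pairwise (fun i j => allrel (fun k l => r (f i k) (f j l)) t t) s.
Proof.
elim: s => //= i s ih; rewrite pairwise_cat => /and3P[rs _ /ih ->]; rewrite andbT.
elim: s rs {ih} => //= j s ih; rewrite allrel_catr => /andP[+ /ih ->].
by rewrite allrel_mapl allrel_mapr => ->.
Qed.

Lemma pairwise_ord m (r : rel 'I_m) : pairwise r (enum 'I_m) ->
  forall i j : 'I_m, (i < j)%N -> r i j.
Proof.
move=> + i j ij => /(pairwiseP i)/(_ i j); rewrite !nth_ord_enum; apply=> //.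
  by rewrite inE size_enum_ord.
by rewrite inE size_enum_ord.
Qed.

Lemma stereo_lt_trans (o : S1 R) : transitive (relpre (stereo o) <%R).
Proof. by move=> y x z; apply: lt_trans. Qed.

Lemma esgn_lt (o a b : S1 R) : stereo o a < stereo o b -> esgn o a b = 1.
Proof. by move=> ab; rewrite /esgn gtr0_sgz // subr_gt0. Qed.

Lemma anticlockwise_ord m (p : 'I_m -> S1 R) : anticlockwise [seq p i | i <- enum 'I_m] ->
  exists o, (forall i, p i != o) /\
    forall i j : 'I_m, (i < j)%N -> esgn o (p i) (p j) = 1.
Proof.
case=> o oP; rewrite sorted_map sorted_pairwise; last exact: stereo_lt_trans.
rewrite pairwise_map => /pairwise_ord ps; exists o; split=> [i|i j ij].
  by apply: contraNneq oP => <-; apply/map_f/mem_enum.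
by apply/esgn_lt/ps.
Qed.

Lemma anticlockwise_pair m d (pc : 'I_m * 'I_d -> S1 R) :
  anticlockwise [seq pc (i, rev_ord k) | i <- enum 'I_m, k <- enum 'I_d] ->
  exists o, (forall t, pc t != o) /\
    forall (i j : 'I_m) k l, (i < j)%N -> esgn o (pc (i, k)) (pc (j, l)) = 1.
Proof.
case=> o oP; rewrite sorted_map sorted_pairwise; last exact: stereo_lt_trans.
move=> /(@pairwise_allpairs _ _ _ _ (fun i k => pc (i, rev_ord k)))/pairwise_ord ps.
exists o; split=> [[i k]|i j k l ij].
  (* The list meets the copies as r_(n-1), ..., r_1, so copy k stands at place [rev_ord k]. *)
  apply: contraNneq oP => <-; apply/allpairsP; exists (i, rev_ord k).
  by rewrite !mem_enum rev_ordK.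
apply/esgn_lt; move/allrelP: (ps _ _ ij) => /(_ (rev_ord k) (rev_ord l)).
by rewrite !mem_enum !rev_ordK; apply.
Qed.

End CutPoint.

(** * Comparison of the two brackets, on generators and then on the whole subfield *)

Theorem theorem7p3 (R : realType) (K : fieldType) (charK : [pchar K] =i pred0)
    (n : nat) (hn : (2 <= n)%N)
    (* P = {p 0 < p 1 < ... < p (m-1) < p 0} in anticlockwise order *)
    (m : nat) (p : 'I_m -> S1 R)
    (hp : anticlockwise [seq p i | i <- enum 'I_m])
    (* pc (i, k) is the point r_(k+1) for r = p i *)
    (pc : 'I_m * 'I_n.-1 -> S1 R)
    (hpc : anticlockwise
             [seq pc (i, rev_ord k) | i <- enum 'I_m, k <- enum 'I_n.-1])
    (QP : fieldType) (iP : {rmorphism Zn K 'I_m n -> QP})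
    (fracP : is_fraction_field iP)
    (brP : QP -> QP -> QP) (swapP : is_swapping_bracketQ iP p brP)
    (QC : fieldType) (iC : {rmorphism Zn K ('I_m * 'I_n.-1)%type n -> QC})
    (fracC : is_fraction_field iC)
    (brC : QC -> QC -> QC) (swapC : is_swapping_bracketQ iC pc brC)
    (mu : QP -> QC)
    (mu1 : mu 1 = 1)
    (muD : {in RT iP &, {morph mu : f g / f + g}})
    (muM : {in RT iP &, {morph mu : f g / f * g}})
    (mu_const : forall c : K, mu (constQ iP c) = constQ iC c)
    (mu_inj : {in RT iP &, injective mu})
    (mu_DR : {in RT iP, forall f, mu f \in DR hn iC})
    (mu_ratio : forall x y z : 'I_m, z != x ->
       mu (pair_ratio iP y z x) = detratio_copies hn iC x y z) :
  {in RT iP &, forall f g, brP f g \in RT iP} /\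
  {in RT iP &, {morph mu : f g / brP f g >-> brC f g}}.
Proof.
have [o [ho hlt]] := anticlockwise_ord hp.
have [o' [ho' hlt']] := anticlockwise_pair hpc.
pose e i j := esgn o (p i) (p j).
(* Each cut point lies in the gap before the first listed point, so both signs are given by the
   order of the indices i and j. *)
have he i j k l : i != j -> esgn o' (pc (i, k)) (pc (j, l)) = e i j.
  rewrite /e -val_eqE neq_ltn => /orP[] ij; first by rewrite hlt ?hlt'.
  by rewrite esgnN [RHS]esgnN hlt ?hlt'.
have e0 i : e i i = 0 by apply: esgnn.
have RTcl : divring_closed (RT iP) by apply: gen_subfield_closed.
have RTc c : constQ iP c \in RT iP by apply: gen_subfield_const.
have RTr x y z : z != x -> pair_ratio iP y z x \in RT iP.
  by move=> zx; apply: gen_subfield_gen; exists x, y, z.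
have [bP _] := swapP; have [bC _] := swapC.
have mu0 := submorph0 RTcl muD.
have bc0 c f : f \in RT iP ->
    brP (constQ iP c) f \in RT iP /\ mu (brP (constQ iP c) f) = brC (mu (constQ iP c)) (mu f).
  rewrite (bracketQ_const swapP c fracP f).1 mu_const (bracketQ_const swapC c fracC _).1.
  by rewrite (subfield0 RTcl).
have b0c c f : f \in RT iP ->
    brP f (constQ iP c) \in RT iP /\ mu (brP f (constQ iP c)) = brC (mu f) (mu (constQ iP c)).
  rewrite (bracketQ_const swapP c fracP f).2 mu_const (bracketQ_const swapC c fracC _).2.
  by rewrite (subfield0 RTcl).
have muJ y x b a : mu (constQ iP (linking K (p y) (p x) (p b) (p a)))
    = constQ iC 2^-1 * (e y b + e x a - e y a - e x b)%:~R.
  rewrite mu_const (@linking_esgn _ _ o) ?rmorphM ?rmorph_int //.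
  by rewrite !inE ![o == _]eq_sym !negb_or !ho.
(* Both brackets are the same polynomial in linking numbers and ratios. The ratios that occur have
   denominators zx or ca, so they are again generators. *)
have gens x y z a b c : z != x -> c != a ->
    let f := pair_ratio iP y z x in let g := pair_ratio iP b c a in
    brP f g \in RT iP /\ mu (brP f g) = brC (mu f) (mu g).
  move=> zx ca f g; rewrite /f /g (bracketQ_pair_ratio swapP) !mu_ratio //.
  rewrite (bracketQ_detratio hn swapC ho' he e0) /=.
  rewrite -!muJ -!mu_ratio //.
  by apply: (submorph_ratio RTcl muD muM); (exact: RTc || exact: RTr).
(* Extension in two passes: first f varies over the subfield with g a generator, then g varies with
   f arbitrary. *)
have gen_r x y z : z != x -> forall f, f \in RT iP ->
    let g := pair_ratio iP y z x in
    brP f g \in RT iP /\ mu (brP f g) = brC (mu f) (mu g).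
  move=> zx f fRT g.
  have [lD lM] := biderivation_l bP g; have [lD' lM'] := biderivation_l bC (mu g).
  have cl := derivation_submorph_closed RTcl mu1 muD muM lD lM lD' lM'.
  suff: {subset RT iP <=
      [pred f | [&& f \in RT iP, brP f g \in RT iP & mu (brP f g) == brC (mu f) (mu g)]]}.
    by move=> /(_ f fRT); rewrite inE => /and3P[_ -> /eqP].
  apply: (gen_subfield_sub cl) => [c0|_ [a [b [c [ca ->]]]]]; rewrite inE.
    by rewrite RTc; have [-> ->] := bc0 c0 g (RTr _ _ _ zx); rewrite eqxx.
  by rewrite RTr //; have [-> ->] := gens a b c x y z ca zx; rewrite eqxx.
have all f g : f \in RT iP -> g \in RT iP ->
    brP f g \in RT iP /\ mu (brP f g) = brC (mu f) (mu g).
  move=> fRT gRT.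
  have [rD rM] := biderivation_r bP f; have [rD' rM'] := biderivation_r bC (mu f).
  have cl := derivation_submorph_closed RTcl mu1 muD muM rD rM rD' rM'.
  suff: {subset RT iP <=
      [pred g | [&& g \in RT iP, brP f g \in RT iP & mu (brP f g) == brC (mu f) (mu g)]]}.
    by move=> /(_ g gRT); rewrite inE => /and3P[_ -> /eqP].
  apply: (gen_subfield_sub cl) => [c0|_ [x [y [z [zx ->]]]]]; rewrite inE.
    by rewrite RTc; have [-> ->] := b0c c0 f fRT; rewrite eqxx.
  by rewrite RTr //; have [-> ->] := gen_r x y z zx f fRT; rewrite eqxx.
by split=> f g fRT gRT; have [] := all f g fRT gRT.
Qed.
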